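(* Let $G$ be a group and let $H,N$ be subgroups of $G$ such that $N\triangleleft G$ and $N\subseteq H$. Then for all integers $n\ge 0$, the pairs $$\left(\frac{H}{N},\frac{G}{N}\right)\quad\text{and}\quad\left(\frac{H}{N\cap\gamma_{n+1}(G)},\frac{G}{N\cap\gamma_{n+1}(G)}\right)$$ are relative $n$-isoclinic. In particular, if $N\cap\gamma_{n+1}(G)=1$, then $(H,G)$ and $(H/N,G/N)$ are relative $n$-isoclinic.
   Context: Groups may be finite or infinite. $Z_n(G)$ denotes the $n$-th term of the upper central series of $G$ ($Z_0(G)=1$), and $\gamma_{n+1}(G)$ the $(n+1)$-th term of the lower central series ($\gamma_1(G)=G$, $\gamma_{k+1}(G)=[\gamma_k(G),G]$). Commutators are left-normed: $[x_1]=x_1$, $[x_1,x_2]=x_1^{-1}x_2^{-1}x_1x_2$ and $[x_1,\dots,x_{k+1}]=[[x_1,\dots,x_k],x_{k+1}]$. For a subgroup $H$ of $G$, $[_nH,G]$ denotes $[H,\dots,H,G]$ ($n$ copies of $H$), i.e. the subgroup of $G$ generated by all $[h_1,\dots,h_n,g]$ with $h_1,\dots,h_n\in H$, $g\in G$ (so $[_0H,G]=G$). Definition (relative $n$-isoclinism). Let $H_i$ be a subgroup of a group $G_i$, $i=1,2$. The pairs $(H_1,G_1)$ and $(H_2,G_2)$ are relative $n$-isoclinic if there is a pair $(\alpha,\beta)$ such that: (i) $\alpha:G_1/Z_n(G_1)\to G_2/Z_n(G_2)$ is an isomorphism whose restriction to $H_1/(Z_n(G_1)\cap H_1)$ is an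 isomorphism onto $H_2/(Z_n(G_2)\cap H_2)$, where $H_i/(Z_n(G_i)\cap H_i)$ is identified with the image $H_iZ_n(G_i)/Z_n(G_i)$ of $H_i$ in $G_i/Z_n(G_i)$; (ii) $\beta:[_nH_1,G_1]\to[_nH_2,G_2]$ is an isomorphism; (iii) for all $h_1,\dots,h_n\in H_1$, $g_1\in G_1$, $k_1,\dots,k_n\in H_2$, $g_2\in G_2$ with $\alpha(h_i(Z_n(G_1)\cap H_1))=k_i(Z_n(G_2)\cap H_2)$ for $1\le i\le n$ and $\alpha(g_1Z_n(G_1))=g_2Z_n(G_2)$, one has $\beta([h_1,\dots,h_n,g_1])=[k_1,\dots,k_n,g_2]$. *)

(* Defs.v *)
From HB Require Import structures.
From mathcomp Require Import all_boot.
From mathcomp Require Import boolp classical_sets functions.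

Set Implicit Arguments.
Unset Strict Implicit.
Unset Printing Implicit Defensive.

Local Open Scope classical_set_scope.
Local Open Scope group_scope.

(* Possibly infinite groups: the ambient group is a [groupType], its subgroups
   are bundled [set]s, and membership is decided classically. *)

Identity Coercion set_to_fun : set >-> Funclass.

Record subgroup (G : groupType) := Subgroup {
  subgroup_set :> set G;
  subgroupP : group_closed [in subgroup_set] }.

Record normalSubgroup (G : groupType) := NormalSubgroup {
  normal_subgroup :> subgroup G;
  normalP : forall x g : G, x \in (normal_subgroup : set G) ->
    x ^ g \in (normal_subgroup : set G) }.

Section SubgroupTheory.
Variables (G : groupType) (H : subgroup G).
Implicit Types x y : G.

Lemma subgroup1 : H 1.
Proof. by case: (subgroupP H); rewrite inE. Qed.

Lemma subgroupF x y : H x -> H y -> H (x / y).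
Proof.
by case: (subgroupP H) => _ HF Hx Hy; have := HF x y; rewrite !inE; apply.
Qed.

Lemma subgroupV x : H x -> H x^-1.
Proof. by move=> Hx; rewrite -div1g; apply: subgroupF => //; exact: subgroup1. Qed.

Lemma subgroupM x y : H x -> H y -> H (x * y).
Proof. by move=> Hx Hy; rewrite -[y]invgK; apply/subgroupF/subgroupV. Qed.

End SubgroupTheory.

Lemma normalJ (G : groupType) (N : normalSubgroup G) (x g : G) :
  N x -> N (x ^ g).
Proof. by move=> Nx; have := @normalP _ N x g; rewrite !inE; apply. Qed.

Lemma subgroup_intro (G : groupType) (A : set G) :
  A 1 -> (forall x y, A x -> A y -> A (x / y)) -> group_closed [in A].
Proof.
by move=> A1 AF; split=> [|x y]; rewrite !inE //; exact: AF.
Qed.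

Lemma normal_intro (G : groupType) (H : subgroup G) :
  (forall x g, H x -> H (x ^ g)) ->
  forall x g : G, x \in (H : set G) -> x ^ g \in (H : set G).
Proof. by move=> HJ x g; rewrite !inE; exact: HJ. Qed.

Section Subgroups.
Variable G : groupType.

Fact trivial_closed : group_closed [in [set (1 : G)]].
Proof. by apply: subgroup_intro => // x y -> ->; rewrite /= divgg. Qed.

Definition trivial_subgroup := Subgroup trivial_closed.

Fact trivial_normal (x g : G) :
  x \in (trivial_subgroup : set G) -> x ^ g \in (trivial_subgroup : set G).
Proof. by apply: normal_intro => {}x {}g ->; rewrite /= conj1g. Qed.

Definition trivialN : normalSubgroup G := NormalSubgroup trivial_normal.

Fact full_closed : group_closed [in [set: G]].
Proof. exact: subgroup_intro. Qed.

Definition full_subgroup := Subgroup full_closed.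

Fact full_normal (x g : G) :
  x \in (full_subgroup : set G) -> x ^ g \in (full_subgroup : set G).
Proof. exact: normal_intro. Qed.

Definition fullN : normalSubgroup G := NormalSubgroup full_normal.

Fact setI_closed (H K : subgroup G) : group_closed [in H `&` K].
Proof.
apply: subgroup_intro => [|x y [Hx Kx] [Hy Ky]].
  by split; exact: subgroup1.
by split; exact: subgroupF.
Qed.

Definition subgroupI (H K : subgroup G) := Subgroup (setI_closed H K).

Fact setI_normal (M N : normalSubgroup G) (x g : G) :
  x \in (subgroupI M N : set G) -> x ^ g \in (subgroupI M N : set G).
Proof. by apply: normal_intro => {}x {}g [Mx Nx]; split; exact: normalJ. Qed.

Definition normalI (M N : normalSubgroup G) : normalSubgroup G :=
  NormalSubgroup (@setI_normal M N).

Fact generated_closed (A : set G) :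
  group_closed [in smallest (fun B : set G => group_closed [in B]) A].
Proof.
apply: subgroup_intro => [B [cB _]|x y Ax Ay B AB].
  exact: (@subgroup1 _ (Subgroup cB)).
by apply: (@subgroupF _ (Subgroup AB.1)); [exact: Ax | exact: Ay].
Qed.

Definition generated (A : set G) : subgroup G :=
  Subgroup (generated_closed A).

Lemma generated_conj (A : set G) (x g : G) :
  (forall a h, A a -> A (a ^ h)) -> generated A x -> generated A (x ^ g).
Proof.
move=> AJ Ax B [cB AB]; apply: (Ax [set y | B (y ^ g)]); split => /= [|a Aa].
  apply: subgroup_intro => /= [|y z By Bz].
    by rewrite conj1g; exact: (@subgroup1 _ (Subgroup cB)).
  by rewrite conjMg conjVg; exact: (@subgroupF _ (Subgroup cB)).
by apply: AB; exact: AJ.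
Qed.

Fact commG_normal (N : normalSubgroup G) (x g : G) :
  let C := generated [set [~ a, b] | a in N & b in [set: G]] in
  x \in (C : set G) -> x ^ g \in (C : set G).
Proof.
apply: normal_intro => {}x {}g; apply: generated_conj => _ h [a Na [b _ <-]].
by rewrite conjRg; exists (a ^ h); [exact: normalJ | exists (b ^ h)].
Qed.

Definition commG (N : normalSubgroup G) : normalSubgroup G :=
  NormalSubgroup (@commG_normal N).

(* The index 0 carries no meaning; it is given the value [gamma 1 = G]. *)
Definition gamma (k : nat) : normalSubgroup G := iter k.-1 commG fullN.

Section Quotient.
Variable N : normalSubgroup G.

Definition coset_rel : rel G := fun x y => x^-1 * y \in (N : set G).

Fact coset_rel_equiv : equiv_class_of coset_rel.
Proof.
rewrite /coset_rel; split=> [x|x y|y x z].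
- by rewrite inE mulVg; exact: subgroup1.
- by apply/idP/idP; rewrite !inE => /subgroupV; rewrite invgM invgK.
- rewrite !inE => Nxy Nyz; rewrite -(mulgK y x^-1) -!mulgA mulgA.
  exact: subgroupM.
Qed.

Canonical coset_equiv := EquivRelPack coset_rel_equiv.

Definition quot : Type := {eq_quot coset_rel}%qT.
HB.instance Definition _ := Choice.copy quot {eq_quot coset_rel}%qT.
HB.instance Definition _ := EqQuotient.copy quot {eq_quot coset_rel}%qT.

Definition coset (x : G) : quot := \pi_quot%qT x.

Lemma cosetP x y : coset x = coset y <-> N (x^-1 * y).
Proof.
rewrite /coset; split=> [/eqmodP|Nxy]; first by rewrite /= /coset_rel inE.
by apply/eqmodP; rewrite /= /coset_rel inE.
Qed.

Lemma coset_repr (u : quot) : coset (repr u) = u.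
Proof. exact: reprK. Qed.

Definition quot_one : quot := coset 1.
Definition quot_mul (u v : quot) : quot := coset (repr u * repr v).
Definition quot_inv (u : quot) : quot := coset (repr u)^-1.

Lemma quot_mulE x y : quot_mul (coset x) (coset y) = coset (x * y).
Proof.
set x' := repr (coset x); set y' := repr (coset y).
have /cosetP Nx : coset x' = coset x by exact: coset_repr.
have /cosetP Ny : coset y' = coset y by exact: coset_repr.
apply/cosetP; rewrite -/x' -/y'.
have -> : (x' * y')^-1 * (x * y) = (x'^-1 * x) ^ y' * (y'^-1 * y).
  by rewrite /conjg invgM -!mulgA mulVKg.
by apply: subgroupM => //; exact: normalJ.
Qed.

Lemma quot_invE x : quot_inv (coset x) = coset x^-1.
Proof.
set x' := repr (coset x).
have /esym/cosetP Nx : coset x' = coset x by exact: coset_repr.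
apply/cosetP; rewrite -/x' invgK.
have -> : x' * x^-1 = (x^-1 * x') ^ x^-1.
  by rewrite /conjg invgK -mulgA mulVKg.
exact: normalJ.
Qed.

Fact quot_mulA : associative quot_mul.
Proof.
move=> u v w; rewrite -[u]coset_repr -[v]coset_repr -[w]coset_repr.
by rewrite !quot_mulE mulgA.
Qed.

Fact quot_mul1 : left_id quot_one quot_mul.
Proof. by move=> u; rewrite -[u]coset_repr quot_mulE mul1g. Qed.

Fact quot_mulr1 : right_id quot_one quot_mul.
Proof. by move=> u; rewrite -[u]coset_repr quot_mulE mulg1. Qed.

Fact quot_mulV : left_inverse quot_one quot_inv quot_mul.
Proof. by move=> u; rewrite -[u]coset_repr quot_invE quot_mulE mulVg. Qed.

Fact quot_mulrV : right_inverse quot_one quot_inv quot_mul.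
Proof. by move=> u; rewrite -[u]coset_repr quot_invE quot_mulE mulgV. Qed.

HB.instance Definition _ :=
  isGroup.Build quot quot_mulA quot_mul1 quot_mulr1 quot_mulV quot_mulrV.

Lemma cosetM x y : coset (x * y) = coset x * coset y.
Proof. by rewrite -quot_mulE. Qed.

Lemma coset1 : coset 1 = 1. Proof. by []. Qed.

Lemma cosetV x : coset x^-1 = (coset x)^-1.
Proof. by rewrite -quot_invE. Qed.

End Quotient.
End Subgroups.

Arguments gamma : clear implicits.

(* The image HN/N of H in G/N, which is H/N when N is contained in H. *)
Section QuotientSubgroup.
Variables (G : groupType) (H : subgroup G) (N : normalSubgroup G).

Fact quot_subgroup_closed : group_closed [in coset N @` H].
Proof.
apply: subgroup_intro => [|_ _ [x Hx <-] [y Hy <-]].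
  by exists 1; first exact: subgroup1.
by exists (x / y); [exact: subgroupF | rewrite cosetM cosetV].
Qed.

Definition quot_subgroup : subgroup (quot N) :=
  Subgroup quot_subgroup_closed.

End QuotientSubgroup.

Definition center (K : groupType) : set K := [set z | forall x, commute z x].

Arguments center : clear implicits.

Section UpperCentral.
Variable G : groupType.

Fact center_preim_closed (Z : normalSubgroup G) :
  group_closed [in coset Z @^-1` center (quot Z)].
Proof.
apply: subgroup_intro => [u|x y Cx Cy u] /=.
  by rewrite coset1; exact/commute_sym/commute1.
rewrite cosetM cosetV; apply/commute_sym/commuteM; first exact/commute_sym/Cx.
by apply/commuteV/commute_sym/Cy.
Qed.

Definition center_preim_subgroup (Z : normalSubgroup G) : subgroup G :=
  Subgroup (center_preim_closed Z).

Fact center_preim_normal (Z : normalSubgroup G) (x g : G) :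
  x \in (center_preim_subgroup Z : set G) ->
  x ^ g \in (center_preim_subgroup Z : set G).
Proof.
apply: normal_intro => {}x {}g /= Cx.
suff -> : coset Z (x ^ g) = coset Z x by [].
by rewrite /conjg !cosetM Cx mulgA cosetV mulVg mul1g.
Qed.

Definition center_preim (Z : normalSubgroup G) : normalSubgroup G :=
  NormalSubgroup (@center_preim_normal Z).

(* Z_{n+1} / Z_n is the center of G / Z_n. *)
Definition upper_central (n : nat) : normalSubgroup G :=
  iter n center_preim (trivialN G).

End UpperCentral.

Arguments upper_central : clear implicits.

(* The left-normed commutator of a nonempty sequence; the value 1 on the empty
   sequence is never used. *)
Definition lcomm (G : groupType) (s : seq G) : G :=
  if s is x :: s' then foldl (@commg G) x s' else 1.

(* The subgroup [_n H, G]; for n = 0 it is G. *)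
Definition iter_comm (G : groupType) (n : nat) (H : subgroup G) : subgroup G :=
  generated [set x | exists2 h : n.-tuple G, (forall i, H (tnth h i)) &
                       exists g : G, x = lcomm (rcons h g)].

(* [f], restricted to [A], is a group isomorphism from [A] onto [B]; its values
   outside [A] are irrelevant. *)
Definition is_isom (G1 G2 : groupType) (A : subgroup G1) (B : subgroup G2)
    (f : G1 -> G2) : Prop :=
  set_bij A B f /\ (forall x y, A x -> A y -> f (x * y) = f x * f y).

Definition relative_isoclinic (n : nat) (G1 G2 : groupType)
    (H1 : subgroup G1) (H2 : subgroup G2) : Prop :=
  let Z1 := upper_central G1 n in
  let Z2 := upper_central G2 n in
  exists (alpha : quot Z1 -> quot Z2) (beta : G1 -> G2),
    [/\ is_isom (full_subgroup (quot Z1)) (full_subgroup (quot Z2)) alpha,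
        is_isom (quot_subgroup H1 Z1) (quot_subgroup H2 Z2) alpha,
        is_isom (iter_comm n H1) (iter_comm n H2) beta &
        forall (h : n.-tuple G1) (g1 : G1) (k : n.-tuple G2) (g2 : G2),
          (forall i, H1 (tnth h i)) -> (forall i, H2 (tnth k i)) ->
          (forall i, alpha (coset Z1 (tnth h i)) = coset Z2 (tnth k i)) ->
          alpha (coset Z1 g1) = coset Z2 g2 ->
          beta (lcomm (rcons h g1)) = lcomm (rcons k g2)].

(* Main.v *)
Require Import Defs.
From HB Require Import structures.
From mathcomp Require Import all_boot.
From mathcomp Require Import boolp classical_sets functions.

(** Both pairs of each claim are images of [(H, G)] under surjective morphisms
    [p1 : G -> G1] and [p2 : G -> G2] that kill the same elements of
    [gamma (n+1)]: the cosets of [N] and of [N :&: gamma (n+1)] in the first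
    claim, the identity and the cosets of [N] in the second one.  Any two such
    images are relative [n]-isoclinic ([isoclinic_common_cover]).

    An element [x] is in [Z_n] exactly when all commutators
    [[x, g_1, ..., g_n]] are trivial ([upper_centralP]).  These commutators lie
    in [gamma (n+1)], so the preimages of [Z_n(G1)] and [Z_n(G2)] in [G]
    coincide, and [p1 x |-> p2 x] induces [alpha].  Likewise
    [[_n H, G] <= gamma (n+1)], so that [p1 x |-> p2 x] is well defined and
    injective from [[_n H1, G1]] to [[_n H2, G2]]; this is [beta].  Both maps
    come from one construction ([isom_between_images]).

    For the compatibility of [alpha] and [beta], lift the given elements of
    [G1] to [G]: [beta] sends their commutator to the commutator of the images
    by [p2] of the lifts, which agree modulo [Z_n(G2)] with the given elements
    of [G2].  It remains to see that a left-normed commutator of weight [n+1]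
    depends only on its entries modulo [Z_n] ([lcomm_congr]).  This rests on
    the classical inclusion [[gamma i, Z_(m+i)] <= Z_m]
    ([gamma_upper_commute]). *)

Local Open Scope classical_set_scope.
Local Open Scope group_scope.

(** * Morphisms and generated subgroups *)

Section CosetMorphism.
Variables (G : groupType) (N : normalSubgroup G).

HB.instance Definition _ :=
  isMultiplicative.Build G (quot N) (coset N) (@cosetM G N).
HB.instance Definition _ :=
  Multiplicative_isUMagmaMorphism.Build G (quot N) (coset N) (coset1 N).

Lemma coset_eq1 x : coset N x = 1 <-> N x.
Proof.
rewrite -(coset1 N); split=> [/esym/cosetP|Nx]; first by rewrite invg1 mul1g.
by apply/esym/cosetP; rewrite invg1 mul1g.
Qed.

Lemma coset_surj : coset N @` [set: G] = [set: quot N].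
Proof.
by apply/seteqP; split=> // u _; exists (repr u) => //; exact: coset_repr.
Qed.

Lemma coset_commute x y :
  commute (coset N x) (coset N y) <-> N [~ x, y].
Proof.
rewrite -coset_eq1 gmulfR.
by split=> [/commgP/eqP | /eqP/commgP].
Qed.

End CosetMorphism.

Lemma generated_min {G : groupType} {A : set G} (K : subgroup G) :
  A `<=` K -> generated A `<=` K.
Proof. by move=> AK; apply: smallest_sub => //; exact: subgroupP. Qed.

Lemma sub_generated {G : groupType} (A : set G) : A `<=` generated A.
Proof. by move=> x Ax B [_]; apply. Qed.

Section Images.
Context {G K : groupType} (p : UMagmaMorphism.type G K).

Fact preim_closed (B : subgroup K) : group_closed [in p @^-1` B].
Proof.
apply: subgroup_intro => [|x y Bx By] /=.
  by rewrite gmulf1; exact: subgroup1.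
by rewrite gmulfF; exact: subgroupF.
Qed.

Fact image_closed (A : subgroup G) : group_closed [in p @` A].
Proof.
apply: subgroup_intro => [|_ _ [x Ax <-] [y Ay <-]].
  by exists 1; [exact: subgroup1 | rewrite gmulf1].
by exists (x / y); [exact: subgroupF | rewrite gmulfF].
Qed.

Lemma image_generated (A : set G) :
  p @` generated A = generated (p @` A).
Proof.
apply/seteqP; split.
  move=> _ [x Ax <-].
  apply: (generated_min (Subgroup (preim_closed (generated (p @` A)))) _ _ Ax).
  by move=> a Aa; apply: sub_generated; exists a.
apply: (generated_min (Subgroup (image_closed (generated A)))).
by move=> _ [a Aa <-]; exists a => //; exact: sub_generated.
Qed.

Lemma lift_tuple n (A : set G) (t : n.-tuple K) :
  (forall i, (p @` A) (tnth t i)) ->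
  exists2 s : n.-tuple G, (forall i, A (tnth s i)) & t = [tuple of map p s].
Proof.
move=> At; have /choice[f Af] i : exists x, A x /\ p x = tnth t i.
  by have [x] := At i; exists x.
exists [tuple f i | i < n] => [i|]; first by rewrite tnth_mktuple; case: (Af i).
by apply: eq_from_tnth => i; rewrite tnth_map tnth_mktuple; case: (Af i).
Qed.

Lemma foldl_commg_morph x (s : seq G) :
  p (foldl (@commg G) x s) = foldl (@commg K) (p x) (map p s).
Proof. by elim: s x => //= y s IHs x; rewrite IHs gmulfR. Qed.

Lemma lcomm_morph (s : seq G) : p (lcomm s) = lcomm (map p s).
Proof. by case: s => [|x s] /=; rewrite ?gmulf1 // foldl_commg_morph. Qed.

Hypothesis p_surj : p @` [set: G] = [set: K].

Lemma image_iter_comm n (H : subgroup G) (L : subgroup K) :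
  p @` H = L -> p @` iter_comm n H = iter_comm n L.
Proof.
move=> pH; rewrite image_generated; congr (subgroup_set (generated _)).
apply/seteqP; split=> [_ [_ [h Hh [g ->]] <-] | _ [t Lt [k ->]]].
  exists [tuple of map p h] => [i|].
    by rewrite tnth_map -pH; exists (tnth h i).
  by exists (p g); rewrite lcomm_morph map_rcons.
have [|h Hh ->] := @lift_tuple n H t; first by move=> i; rewrite pH.
have [g _ <-] : (p @` [set: G]) k by rewrite p_surj.
exists (lcomm (rcons h g)); last by rewrite lcomm_morph map_rcons.
by exists h => //; exists g.
Qed.

End Images.

(** The first isomorphism theorem in the form used here: on a subgroup [S0]
    where [u] and [v] have the same kernel, the correspondence between [u x]
    and [v x] is the graph of an injective morphism.  It is described on all
    subgroups of [S0] at once because [alpha] has to be an isomorphism both on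
    the whole quotient and on the image of [H]. *)
Lemma isom_between_images {A B1 B2 : groupType}
    (u : UMagmaMorphism.type A B1) (v : UMagmaMorphism.type A B2)
    (S0 : subgroup A) :
  (forall x, S0 x -> u x = 1 <-> v x = 1) ->
  exists f : B1 -> B2, (forall x, S0 x -> f (u x) = v x) /\
    forall (S : subgroup A) (T1 : subgroup B1) (T2 : subgroup B2),
      S `<=` S0 -> u @` S = T1 -> v @` S = T2 -> is_isom T1 T2 f.
Proof.
move=> ker_uv.
have fibers x y : S0 x -> S0 y -> u x = u y <-> v x = v y.
  move=> Sx Sy; have := ker_uv _ (subgroupF Sx Sy); rewrite !gmulfF => -[uv vu].
  by split=> E; apply: divg1_eq; [apply: uv | apply: vu]; rewrite E divgg.
(* Outside the image of S0 the value is arbitrary. *)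
have /choice[f fP] b : exists c, forall x, S0 x -> u x = b -> v x = c.
  have [[x [Sx <-]]|nox] := pselect (exists x, S0 x /\ u x = b).
    by exists (v x) => y Sy /fibers; apply.
  by exists 1 => x Sx ux; case: nox; exists x.
have fu x : S0 x -> f (u x) = v x by move=> Sx; exact/esym/fP.
exists f; split=> // S T1 T2 SS0 uS vS; rewrite /is_isom -uS -vS.
split; first split.
- by move=> _ [x Sx <-]; rewrite /= fu; [exists x | exact: SS0].
- move=> _ _ /set_mem[x Sx <-] /set_mem[y Sy <-].
  by rewrite !fu; [move/fibers; apply | |]; exact: SS0.
- by move=> _ [x Sx <-]; exists (u x); [exists x | rewrite fu //; exact: SS0].
- move=> _ _ [x Sx <-] [y Sy <-].
  by rewrite -gmulfM !fu ?gmulfM //; apply: SS0 => //; exact: subgroupM.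
Qed.

(** * Lower and upper central series *)

Lemma conjg_commg {Q : groupType} (x y : Q) : x ^ y = x * [~ x, y].
Proof. by rewrite commgEl mulVKg. Qed.

(** Perturbing the entries of a commutator does not change it if the first
    perturbation is central and the second one commutes with all that it
    meets: [[c, x * v]] is the conjugate by [v] of [c ^ x], up to [c^-1]. *)
Lemma commg_perturb {Q : groupType} (c w x v : Q) :
  (forall q, commute w q) -> commute v c -> commute v (c ^ x) ->
  [~ c * w, x * v] = [~ c, x].
Proof.
move=> wQ vc vcx.
have fix_conj (a b : Q) : commute a b -> a ^ b = a.
  by move=> ab; apply/conjg_fixP/commgP.
rewrite !commgEl conjMg (fix_conj w) // conjgM (fix_conj (c ^ x)).
  by rewrite invgM -mulgA [c^-1 * _]mulgA -(wQ _) mulKg.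
exact: commute_sym.
Qed.

Section CentralSeries.
Context {G : groupType}.
Implicit Types (x y z c d : G) (s t : seq G).

Local Notation gamma := (gamma G).
Local Notation Z := (upper_central G).

Lemma gamma_commg i x y : gamma i.+1 x -> gamma i.+2 [~ x, y].
Proof.
by move=> gx; apply: sub_generated; exists x => //; exists y.
Qed.

Lemma gamma_foldl_commg i x s :
  gamma i.+1 x -> gamma (size s + i).+1 (foldl (@commg G) x s).
Proof.
elim: s i x => [//|y s IHs] i x gx.
by rewrite [size _]/= addSnnS; exact: IHs (gamma_commg _ _ y gx).
Qed.

Lemma iter_comm_sub_gamma n (H : subgroup G) : iter_comm n H `<=` gamma n.+1.
Proof.
apply: generated_min => _ [h _ [g ->]].
have := size_rcons h g; rewrite size_tuple.
case: (rcons h g) => //= x s [<-].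
by have := @gamma_foldl_commg 0 x s I; rewrite addn0.
Qed.

Lemma upper_centralS m x : Z m.+1 x <-> forall y, Z m [~ x, y].
Proof.
split=> [Zx y|Zx]; first by apply/coset_commute; exact: Zx.
suff: center (quot (Z m)) (coset (Z m) x) by [].
by move=> u; rewrite -[u]coset_repr; apply/coset_commute.
Qed.

Lemma upper_centralP m x :
  Z m x <-> forall s, size s = m -> foldl (@commg G) x s = 1.
Proof.
elim: m x => [|m IHm] x.
  by split=> [-> [] // | /(_ [::])]; apply.
rewrite upper_centralS; split=> [Zx [//|y s] [sz_s] | Zx y] /=.
  by have /IHm := Zx y; apply.
by apply/IHm => s sz_s; apply: (Zx (y :: s)); rewrite /= sz_s.
Qed.

(** The inclusion [[gamma (i+1), Z_(m+i+1)] <= Z_m], read in the quotient by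
    [Z_m].  In the inductive step, [z] lies in [Z_(m+i+2)], and conjugation by
    [z] multiplies the entries of a generator [[a, b]] of [gamma (i+2)] by
    [[a, z]], which is central modulo [Z_m] (use the induction hypothesis at
    [m+1]), and by [[b, z]], which lies in [Z_(m+i+1)] and so commutes modulo
    [Z_m] with both [a] and [a ^ b].  By [commg_perturb], [z] centralises
    [[a, b]] modulo [Z_m]; this argument takes the place of the Hall-Witt
    identity. *)
Lemma gamma_upper_commute i m c z :
  gamma i.+1 c -> Z (m + i.+1) z -> commute (coset (Z m) c) (coset (Z m) z).
Proof.
elim: i m c z => [|i IHi] m c z gc.
  by rewrite addn1 => Zz; apply/commute_sym; exact: Zz.
rewrite addnS => Zz.
pose C := [set x | commute (coset (Z m) z) (coset (Z m) x)].
have C_closed : group_closed [in C].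
  apply: subgroup_intro => [|x y Cx Cy]; rewrite /C /= ?coset1.
    exact: commute1.
  by rewrite gmulfF; apply: commuteM => //; exact: commuteV.
apply/commute_sym; apply: (generated_min (Subgroup C_closed) _ _ gc).
move=> _ [a ga [b _ <-]]; apply/commute_sym/commgP/conjg_fixP.
rewrite gmulfR conjRg !conjg_commg.
have central_az : Z m.+1 [~ a, z].
  by apply/coset_commute; apply: IHi ga _; rewrite addSn.
have Zbz : Z (m + i.+1) [~ b, z].
  apply/coset_commute/commute_sym/coset_commute.
  exact: (upper_centralS _ _).1 Zz b.
rewrite -![[~ coset _ _, coset _ z]]gmulfR; apply: commg_perturb => //.
- by apply/commute_sym; exact: IHi.
- by rewrite -gmulfJ; apply/commute_sym/IHi => //; exact: normalJ.
Qed.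

(** Each commutator with an entry of [s] or [t] gains one step in the upper
    central series: a perturbation of [c] in [Z_(r+1)] becomes central modulo
    [Z_r], and a perturbation of an entry in [Z_(r+i+1)] commutes with
    [gamma (i+1)] modulo [Z_r].  After the last entry the congruence is modulo
    [Z_0], that is, an equality. *)
Lemma foldl_commg_congr i c d s t : size s = size t ->
  gamma i.+1 c -> gamma i.+1 d ->
  coset (Z (size s)) c = coset (Z (size s)) d ->
  (forall j, coset (Z (size s + i)) (nth 1 s j) =
             coset (Z (size s + i)) (nth 1 t j)) ->
  foldl (@commg G) c s = foldl (@commg G) d t.
Proof.
elim: s t i c d => [|x s IHs] [|y t] //= i c d.
  move=> _ _ _ /cosetP cd _; have : c^-1 * d = 1 by exact: cd.
  by move/(congr1 (fun e => c * e)); rewrite mulVKg mulg1.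
move=> [sz_st] gc gd /cosetP cd st.
apply: (IHs _ i.+1) => //.
- exact: gamma_commg.
- exact: gamma_commg.
- rewrite !gmulfR.
  have /cosetP xy : coset (Z (size s + i.+1)) x = coset (Z (size s + i.+1)) y.
    by rewrite -addSnnS; exact: (st 0%N).
  rewrite -[d](mulVKg c) -[y](mulVKg x).
  rewrite [X in _ = [~ X, _]]gmulfM [X in _ = [~ _, X]]gmulfM.
  apply/esym/commg_perturb => //; apply/commute_sym.
    exact: gamma_upper_commute xy.
  by rewrite -gmulfJ; apply: gamma_upper_commute xy; exact: normalJ.
- by move=> j; rewrite addnS -addSn; exact: (st j.+1).
Qed.

Lemma lcomm_congr s t n : size s = n.+1 -> size t = n.+1 ->
  (forall j, coset (Z n) (nth 1 s j) = coset (Z n) (nth 1 t j)) ->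
  lcomm s = lcomm t.
Proof.
case: s t => [|x s] [|y t] //= [<-] [sz_t] st.
apply: (@foldl_commg_congr 0) => //; first exact: (st 0%N).
by move=> j; rewrite addn0; exact: (st j.+1).
Qed.

End CentralSeries.

(** * Isoclinism of images with the same kernel on the lower central series *)

(** Since the commutators on the right lie in [gamma (n+1)], the preimage of
    [Z_n(K)] depends only on the elements of [gamma (n+1)] that [p] kills. *)
Lemma preim_upper_central {G K : groupType} (p : UMagmaMorphism.type G K) n x :
  p @` [set: G] = [set: K] ->
  upper_central K n (p x) <->
  forall s : seq G, size s = n -> p (foldl (@commg G) x s) = 1.
Proof.
move=> p_surj; rewrite upper_centralP; split=> Zx s sz_s.
  by rewrite foldl_commg_morph Zx // size_map.
have [|h _ s_def] := lift_tuple p _ [set: G] (in_tuple s).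
  by move=> i; rewrite p_surj.
have -> : s = map p h := congr1 val s_def.
by rewrite -foldl_commg_morph Zx // size_tuple.
Qed.

(** Working in a common cover [G] makes the situation symmetric in the two
    pairs, and makes it unnecessary to compute the central series of the
    images: the maps [alpha] and [beta] are both the correspondence
    [p1 x |-> p2 x], on all [x] modulo [Z_n] and on [x] in [gamma (n+1)]. *)
Lemma isoclinic_common_cover n {G G1 G2 : groupType}
    (H : subgroup G) (H1 : subgroup G1) (H2 : subgroup G2)
    (p1 : UMagmaMorphism.type G G1) (p2 : UMagmaMorphism.type G G2) :
  p1 @` [set: G] = [set: G1] -> p2 @` [set: G] = [set: G2] ->
  p1 @` H = H1 -> p2 @` H = H2 ->
  (forall x, gamma G n.+1 x -> p1 x = 1 <-> p2 x = 1) ->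
  relative_isoclinic n H1 H2.
Proof.
move=> p1_surj p2_surj p1H p2H ker12.
pose u : UMagmaMorphism.type _ _ := coset (upper_central G1 n) \o p1.
pose v : UMagmaMorphism.type _ _ := coset (upper_central G2 n) \o p2.
have ker_uv x : full_subgroup G x -> u x = 1 <-> v x = 1.
  move=> _; rewrite /u /v /= !coset_eq1 !preim_upper_central //.
  have gx s : size s = n -> gamma G n.+1 (foldl (@commg G) x s).
    by move=> <-; have := @gamma_foldl_commg _ 0 x s I; rewrite addn0.
  by split=> E s sz_s; have [E1 E2] := ker12 _ (gx s sz_s); auto.
have [alpha [alphaE alpha_isom]] := isom_between_images u v _ ker_uv.
have [beta [betaE beta_isom]] := isom_between_images p1 p2 _ ker12.
exists alpha, beta; split.
- by apply: (alpha_isom (full_subgroup G)) => //;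
    rewrite /u /v -image_comp ?p1_surj ?p2_surj coset_surj.
- by apply: (alpha_isom H) => //; rewrite /u /v -image_comp ?p1H ?p2H.
- apply: (beta_isom (iter_comm n H)); first exact: iter_comm_sub_gamma.
    exact: image_iter_comm.
  exact: image_iter_comm.
- move=> h1 g1 k g2 Hh1 _ hk gk.
  have [|h Hh h1E] := lift_tuple p1 _ H h1; first by move=> i; rewrite p1H.
  have [g _ g1E] : (p1 @` [set: G]) g1 by rewrite p1_surj.
  rewrite h1E -g1E /= -map_rcons -lcomm_morph betaE; last first.
    apply: (iter_comm_sub_gamma n H); apply: sub_generated.
    by exists h => //; exists g.
  rewrite lcomm_morph map_rcons; apply: (lcomm_congr _ _ n).
  + by rewrite size_rcons size_map size_tuple.
  + by rewrite size_rcons size_tuple.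
  move=> j; rewrite !nth_rcons size_map !size_tuple.
  have [jn|_] := ltnP j n; last first.
    (* Past both sequences the two entries are the default 1. *)
    by case: eqP => // _; rewrite -gk -g1E -[RHS]/(alpha (u g)) alphaE.
  have := hk (Ordinal jn); rewrite h1E tnth_map.
  rewrite -[X in X = _]/(alpha (u _)) alphaE // (tnth_nth 1) (tnth_nth 1) /=.
  by rewrite (nth_map 1) // size_tuple.
Qed.

Theorem theoremC (G : groupType) (H : subgroup G) (N : normalSubgroup G)
    (NH : N `<=` H) (n : nat) :
  relative_isoclinic n (quot_subgroup H N)
                       (quot_subgroup H (normalI N (gamma G n.+1))) /\
  (N `&` gamma G n.+1 = [set 1] ->
   relative_isoclinic n H (quot_subgroup H N)).
Proof.
split=> [|NG1].
  apply: (isoclinic_common_cover n H _ _ (coset N)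
            (coset (normalI N (gamma G n.+1)))) => //; try exact: coset_surj.
  by move=> x gx; rewrite !coset_eq1; split=> [Nx|[]].
apply: (isoclinic_common_cover n H _ _ idfun (coset N)) => //;
  try exact: image_id; try exact: coset_surj.
move=> x gx; rewrite coset_eq1 /=; split=> [->|Nx]; first exact: subgroup1.
by have : (N `&` gamma G n.+1) x by []; rewrite NG1.
Qed.
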